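(* Let $g\in\mathbb{F}_q[t]$ be a square-free polynomial of odd degree, and assume $3\nmid q$ and $3\nmid q-1$. Then there are infinitely many cubic extensions $K$ of $\mathbb{F}_q(t)$ whose discriminant is relatively prime to $g$ such that $g$ is not Carmichael in $K$.
   Context: $\mathbb{F}_q$ is the finite field with $q$ elements. A finite ring $S$ is a Carmichael ring if $S$ is not a field and $a^{|S|}=a$ for every $a\in S$; an ideal $I$ of a ring $R$ is a Carmichael ideal if $R/I$ is a Carmichael ring. For a finite extension $K$ of $\mathbb{F}_q(t)$, $\mathcal{O}_K$ denotes the integral closure of $\mathbb{F}_q[t]$ in $K$, and an element $\alpha\in\mathcal{O}_K$ is Carmichael in $K$ if $\alpha\mathcal{O}_K$ is a Carmichael ideal of $\mathcal{O}_K$. The discriminant of $K$ is the discriminant ideal of $\mathcal{O}_K$ over $\mathbb{F}_q[t]$; ''relatively prime to $g$'' means no irreducible factor of $g$ divides it. *)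

(* Defs.v *)
From HB Require Import structures.
From mathcomp Require Import all_boot all_order all_algebra all_field.
Set Implicit Arguments. Unset Strict Implicit. Unset Printing Implicit Defensive.
Import GRing.Theory.
Local Open Scope ring_scope.

Section FunctionField.
Context (F : finFieldType).

Local Notation Fqt := {fraction {poly F}}.

Definition squarefree_poly (g : {poly F}) : Prop :=
  g != 0 /\ forall d : {poly F}, d * d %| g -> (size d <= 1)%N.

Context (K : fieldExtType Fqt).

Definition polyK (p : {poly F}) : K := (FracField.tofrac p)%:A.

Definition integralK (x : K) : Prop :=
  exists P : {poly {poly F}}, P \is monic /\ root (map_poly polyK P) x.

Definition congr_mod (a x y : K) : Prop :=
  exists z : K, integralK z /\ x - y = a * z.

Definition quot_card (a : K) (N : nat) : Prop :=
  exists r : 'I_N -> K,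
    (forall i, integralK (r i)) /\
    (forall i j, congr_mod a (r i) (r j) -> i = j) /\
    (forall x, integralK x -> exists i, congr_mod a x (r i)).

Definition quot_is_field (a : K) : Prop :=
  ~ congr_mod a 1 0 /\
  forall x, integralK x -> ~ congr_mod a x 0 ->
    exists y, integralK y /\ congr_mod a (x * y) 1.

Definition carmichael_ideal (a : K) : Prop :=
  exists N : nat, quot_card a N /\ ~ quot_is_field a /\
    forall x, integralK x -> congr_mod a (x ^+ N) x.

Definition carmichael_in (alpha : K) : Prop :=
  integralK alpha /\ carmichael_ideal alpha.

Definition traceK (x : K) : Fqt :=
  \tr (passmx.mxof (vbasis {:K}) (vbasis {:K}) (amulr x)).

(* integral basis of O_K over F_q[t] (O_K has rank [K:F_q(t)]) *)
Definition integral_basis (w : 'I_(\dim {:K}) -> K) : Prop :=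
  (forall i, integralK (w i)) /\
  (forall c : 'I_(\dim {:K}) -> {poly F},
      \sum_i polyK (c i) * w i = 0 -> forall i, c i = 0) /\
  (forall x, integralK x ->
      exists c : 'I_(\dim {:K}) -> {poly F}, x = \sum_i polyK (c i) * w i).

Definition disc_generator (d : {poly F}) : Prop :=
  exists w, integral_basis w /\
    FracField.tofrac d = \det (\matrix_(i, j) traceK (w i * w j)).

Definition disc_coprime_to (g : {poly F}) : Prop :=
  exists d : {poly F}, disc_generator d /\
    forall p : {poly F}, irreducible_poly p -> p %| g -> ~~ (p %| d).

End FunctionField.

Definition ext_iso (F : finFieldType) (K1 K2 : fieldExtType {fraction {poly F}})
  : Prop := exists f : {lrmorphism K1 -> K2}, bijective f.

Definition cubic_ext (F : finFieldType) (K : fieldExtType {fraction {poly F}})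
  : Prop := \dim {:K} = 3%N.

(* Main.v *)
Require Import Defs.
From HB Require Import structures.
From mathcomp Require Import all_boot all_order all_algebra all_field.
From mathcomp Require Import ring generic_quotient.
From Stdlib Require Import Classical_Prop.
Set Implicit Arguments. Unset Strict Implicit. Unset Printing Implicit Defensive.
Import GRing.Theory.
Local Open Scope ring_scope.

(** Write [A = F_q[t]] and let [K] be generated by a cube root [th] of an
    irreducible [m] in [A] with [deg m > deg g].  As [m] is squarefree and 3 is
    invertible, the ring of integers is [A[th]], with discriminant [-27 m^2],
    which is prime to [g].  The quotient of [A[th]] by [g] has
    [N = q^(3 deg g)] elements, and [N = 2] modulo 3 because [q = 2] modulo 3
    and [deg g] is odd.  Hence [th^N] is an element of [A] times [th^2], which
    is not congruent to [th] modulo [g].  Finally, [K] contains no cube root of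
    an irreducible polynomial prime to [m], so distinct [m] give non-isomorphic
    fields and the pigeonhole principle defeats any finite list. *)

(** In characteristic 3 the order of [F] would be a power of 3, with positive exponent because a
    field has more than one element. *)
Lemma natr3_neq0 (F : finFieldType) : ~~ (3 %| #|F|)%N -> 3%:R != 0 :> F.
Proof.
move=> n3; apply/eqP=> F3; move: n3; apply/negP/negPn.
have ch3 : 3 \in [pchar F] by apply/andP; split=> //; rewrite F3.
have cF : #|F| = (3 ^ logn 3 #|F|)%N := card_pprimeChar ch3.
case: (logn 3 #|F|) cF => [F1|n ->]; last by rewrite dvdn_exp.
by have := finNzRing_gt1 F; rewrite F1.
Qed.

(** * Divisibility by irreducible polynomials *)

Section Poly.
Context (F : fieldType).
Implicit Types p q m a b c : {poly F}.

Lemma irredp_dvdM p a b : irreducible_poly p -> p %| a * b -> (p %| a) || (p %| b).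
Proof.
move=> ip; case: (boolP (p %| a)) => //= na.
by rewrite Gauss_dvdpr ?irreducible_poly_coprime.
Qed.

Lemma irredp_dvdX p a n : irreducible_poly p -> p %| a ^+ n -> p %| a.
Proof.
move=> ip; elim: n => [|n IH]; last by rewrite exprS => /(irredp_dvdM ip)/orP[].
rewrite expr0 => /dvdp_leq; rewrite oner_neq0 size_poly1 => /(_ isT).
by case: ip => /ltn_geF ->.
Qed.

Lemma irredp_dvd p q : irreducible_poly p -> irreducible_poly q -> p %| q -> q %| p.
Proof.
move=> [p1 _] iq /iq; rewrite neq_ltn p1 orbT => /(_ isT).
by rewrite eqp_sym => /andP[].
Qed.

Lemma irredp_factor q : (1 < size q)%N -> exists2 p, irreducible_poly p & p %| q.
Proof.
have [n] := ubnP (size q); elim: n q => // n IH q /ltnSE qn q1.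
have [iq|niq] := classic (irreducible_poly q); first by exists q.
have [p [p1 pq npq]] : exists p, [/\ size p != 1, p %| q & ~~ (p %= q)].
  apply: NNPP => no; apply: niq; split=> // p p1 pq; apply: contraT => npq.
  by case: no; exists p.
have q0 : q != 0 by rewrite -size_poly_gt0 (ltn_trans _ q1).
have p0 : p != 0 by apply: dvdpN0 pq q0.
have sp : (size p < size q)%N.
  by rewrite ltn_neqAle (dvdp_leq q0 pq) (contra _ npq) // dvdp_size_eqp.
have [|r ir rp] := IH p (leq_trans sp qn).
  by rewrite ltn_neqAle eq_sym p1 size_poly_gt0.
by exists r => //; exact: dvdp_trans rp pq.
Qed.

(** Infinite descent: [m] divides [a], then [b], and cancelling [m ^+ 3] leaves the same equation
    with a smaller [b]. It serves to show that irreducible polynomials are not cubes in the fraction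
    field. *)
Lemma irredp_not_cube_ratio m a b :
  irreducible_poly m -> a ^+ 3 = m * b ^+ 3 -> b = 0.
Proof.
move=> im; have m0 := irredp_neq0 im.
have [n] := ubnP (size b); elim: n a b => // n IH a b /ltnSE bn eqab.
have /dvdpP[a1 ea] : m %| a by apply: (@irredp_dvdX _ _ 3); rewrite // eqab dvdp_mulr.
have e2 : b ^+ 3 = m ^+ 2 * a1 ^+ 3.
  by apply: (mulfI m0); rewrite -eqab ea; ring.
have /dvdpP[b1 eb] : m %| b.
  by apply: (@irredp_dvdX _ _ 3); rewrite // e2 expr2 -mulrA dvdp_mulr.
have e3 : a1 ^+ 3 = m * b1 ^+ 3.
  by apply: (mulfI (expf_neq0 2 m0)); rewrite -e2 eb; ring.
have [b10|b10] := eqVneq b1 0; first by rewrite eb b10 mul0r.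
rewrite eb (IH _ _ _ e3) ?mul0r //; apply: leq_trans bn.
rewrite eb size_mul //; case: im => m1 _.
by move: m1; case: (size m) => [|[|k]] // _; rewrite !addnS ltnS leq_addr.
Qed.

(* Multiplying out, [a^3], [m b^3] and [m^2 c^3] are all congruent to [-2 s]
   modulo [p], where [s = m a b c], while their product is [s^3]: hence
   [9 s^3 = 0] modulo [p]. *)
Lemma pure_cubic_reduced p m a b c :
  3%:R != 0 :> F -> irreducible_poly p -> ~~ (p %| m) ->
  p %| a ^+ 2 + 2%:R * m * b * c -> p %| 2%:R * a * b + m * c ^+ 2 ->
  p %| b ^+ 2 + 2%:R * a * c ->
  [/\ p %| a, p %| b & p %| c].
Proof.
move=> F3 ip npm /(dvdp_mull a) pu /(dvdp_mull (m * c)) pw /(dvdp_mull (m * b)) pv.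
set s := m * a * b * c.
have {}pu : p %| a ^+ 3 + 2%:R * s by move: pu; congr (_ %| _); rewrite /s; ring.
have {}pv : p %| m * b ^+ 3 + 2%:R * s by move: pv; congr (_ %| _); rewrite /s; ring.
have {}pw : p %| m ^+ 2 * c ^+ 3 + 2%:R * s by move: pw; congr (_ %| _); rewrite /s; ring.
have ps : p %| s.
  apply: (@irredp_dvdX _ _ 3) => //.
  have F9 : 9%:R != 0 :> F by rewrite (natrM _ 3 3) mulf_neq0.
  rewrite -(dvdpZr _ _ F9) -mul_polyC rmorph_nat.
  set u := _ + _ in pu; set v := _ + _ in pv; set w := _ + _ in pw.
  have -> : 9%:R * s ^+ 3 = u * (v * w - 2%:R * s * (v + w) + 4%:R * s ^+ 2)
     + v * (4%:R * s ^+ 2 - 2%:R * s * w) + w * (4%:R * s ^+ 2).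
    by rewrite /u /v /w /s; ring.
  by rewrite !dvdp_add // dvdp_mulr.
have p2s : p %| 2%:R * s by rewrite dvdp_mull.
move: pu pv pw; rewrite !(dvdp_addl _ p2s) => pu pv pw.
split; first exact: irredp_dvdX pu.
  by case/(irredp_dvdM ip)/orP: pv => [|/(irredp_dvdX ip)//]; rewrite (negPf npm).
case/(irredp_dvdM ip)/orP: pw => /(irredp_dvdX ip) //; by rewrite (negPf npm).
Qed.

End Poly.

(** Euclid's argument: with [P] the product of all nonzero polynomials of size at most [N], an
    irreducible factor of [P * 'X + 1] cannot be one of them. The factor ['X] keeps this polynomial
    nonconstant even if [P] is constant. *)
Lemma irredp_large (F : finFieldType) (N : nat) :
  exists2 p : {poly F}, irreducible_poly p & (N < size p)%N.
Proof.
pose P : {poly F} := \prod_(v : 'rV[F]_N | rVpoly v != 0) rVpoly v.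
have P0 : P != 0 by apply/prodf_neq0.
have [|p ip pP] := @irredp_factor F (P * 'X + 1).
  by rewrite size_MXaddC (negPf P0) /= ltnS size_poly_gt0.
exists p => //; rewrite ltnNge; apply/negP=> sp.
have pdP : p %| P * 'X.
  apply: dvdp_mulr; rewrite /P (bigD1 (poly_rV p)) /= ?poly_rV_K ?irredp_neq0 //.
  exact: dvdp_mulIl.
move: pP; rewrite dvdp_addr // => /dvdp_leq; rewrite oner_neq0 size_poly1 => /(_ isT).
by case: ip => /ltn_geF ->.
Qed.

Lemma fracP (R : idomainType) (x : {fraction R}) :
  exists a b : R, b != 0 /\ x = FracField.tofrac a / FracField.tofrac b.
Proof.
elim/quotW: x => y; exists y.1, y.2; have y0 := denom_ratioP y; split=> //.
have e0 : FracField.tofrac y.2 != 0 by rewrite tofrac_eq0.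
apply: (mulIf e0); rewrite divfK // -[in LHS](Ratio_numden y).
unlock FracField.tofrac.
rewrite -[_ * _]/(FracField.mul _ _) -FracField.pi_mul.
apply/eqP. rewrite FracField.equivf_def /FracField.mulf.
by rewrite !numden_Ratio ?mulf_neq0 ?oner_neq0 // !mulr1 mulrC.
Qed.

HB.instance Definition _ (F : finFieldType) (K : fieldExtType {fraction {poly F}}) :=
  GRing.RMorphism.copy (@polyK F K) (in_alg K \o (@FracField.tofrac {poly F})).

(** A cubic without roots is irreducible, and a root [a / b] would give [a ^+ 3 = m * b ^+ 3] with
    [b] nonzero. *)
Lemma Xn3_subC_irredp (F : finFieldType) (m : {poly F}) :
  irreducible_poly m -> irreducible_poly ('X^3 - (FracField.tofrac m)%:P).
Proof.
move=> im; apply: cubic_irreducible; first by rewrite size_XnsubC.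
move=> x; apply/negP; rewrite /root !hornerE subr_eq0 => /eqP.
have [a [b [b0 ->]]] := fracP x => /eqP.
have e0 : FracField.tofrac b ^+ 3 != 0 by rewrite expf_neq0 // tofrac_eq0.
rewrite expr_div_n -(inj_eq (mulIf e0)) divfK // -!tofracXn -tofracM tofrac_eq => /eqP.
by move/(irredp_not_cube_ratio im)/eqP; rewrite (negPf b0).
Qed.

(** * Integral elements over F_q[t] *)

Section FunctionFieldExtension.
Context (F : finFieldType) (K : fieldExtType {fraction {poly F}}).
Local Notation pK := (polyK K).

Lemma polyK_eq0 a : (pK a == 0) = (a == 0).
Proof. by rewrite /polyK -in_algE fmorph_eq0 tofrac_eq0. Qed.

Lemma scale_tofrac a (x : K) : FracField.tofrac a *: x = pK a * x.
Proof. by rewrite mulr_algl. Qed.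

Lemma integralK_over (x : K) : integralK x <-> integralOver pK x.
Proof. by split=> [[P [mP rP]]|[P mP rP]]; exists P. Qed.

Lemma integralK_polyK p : integralK (pK p).
Proof. by apply/integralK_over; exact: integral_id. Qed.

Lemma integralKM (x y : K) : integralK x -> integralK y -> integralK (x * y).
Proof. by rewrite !integralK_over; exact: integral_mul. Qed.

Lemma integralK_cube_root (x : K) p : x ^+ 3 = pK p -> integralK x.
Proof.
move=> x3; exists ('X^3 - p%:P); split; first by rewrite monicXnsubC.
by rewrite /root rmorphB /= map_polyXn map_polyC !hornerE /= x3 subrr.
Qed.

End FunctionFieldExtension.

(** * Traces in an arbitrary basis and small determinants *)

Lemma traceK_basis (F : finFieldType) (K : fieldExtType {fraction {poly F}})
    (e : (\dim {:K}).-tuple K) (x : K) :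
  basis_of {:K} e -> traceK x = \tr (passmx.mxof e e (amulr x)).
Proof.
move=> eB; have vB := vbasisP {:K}.
(* Composing with the identity on both sides produces the two change-of-basis matrices; cyclicity of
   the trace brings them together, where they cancel. *)
rewrite /traceK -[amulr x in LHS]comp_lfun1r (passmx.mxof_comp _ _ eB).
rewrite -[amulr x in LHS]comp_lfun1l (passmx.mxof_comp _ _ eB).
rewrite mxtrace_mulC -mulmxA -(passmx.mxof_comp _ _ vB) comp_lfun1l.
by rewrite passmx.mxof1 ?mulmx1 // (basis_free eB).
Qed.

Lemma traceK_coord (F : finFieldType) (K : fieldExtType {fraction {poly F}})
    (e : (\dim {:K}).-tuple K) (x : K) :
  basis_of {:K} e -> traceK x = \sum_i coord e i (e`_i * x).
Proof.
move=> eB; rewrite (traceK_basis _ eB); apply: eq_bigr => i _.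
by rewrite /passmx.mxof !mxE /= passmx.vecof_delta lfunE.
Qed.

Lemma det_mx22 (R : comNzRingType) (A : 'M[R]_2) :
  \det A = A ord0 ord0 * A ord_max ord_max - A ord0 ord_max * A ord_max ord0.
Proof.
rewrite (expand_det_row _ ord0) !big_ord_recl big_ord0 /cofactor !det_mx11 !mxE /=.
have -> : lift ord0 0 = ord_max :> 'I_2 by apply: val_inj.
have -> : lift ord_max 0 = ord0 :> 'I_2 by apply: val_inj.
rewrite /= expr0 expr1; ring.
Qed.

(** The trace form on powers of one element has entries depending only on [i + j]. The size is a
    variable [n] because [\dim {:K}] equals 3 only propositionally. *)
Lemma det_hankel3 (R : comNzRingType) (t : nat -> R) n : n = 3%N ->
  \det (\matrix_(i < n, j < n) t (i + j)%N) =
  t 0%N * (t 2%N * t 4%N - t 3%N ^+ 2) - t 1%N * (t 1%N * t 4%N - t 2%N * t 3%N)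
  + t 2%N * (t 1%N * t 3%N - t 2%N ^+ 2).
Proof.
move=> ->; rewrite (expand_det_row _ ord0) !big_ord_recl big_ord0 /cofactor.
by rewrite !det_mx22 !mxE /= /bump /=; ring.
Qed.

(** * Coordinates on 1, [th], [th ^+ 2] in a pure cubic field *)

Section PureCubic.
Context (F : finFieldType) (m : {poly F}).
Hypothesis F3 : 3%:R != 0 :> F.
Hypothesis im : irreducible_poly m.
Context (K : fieldExtType {fraction {poly F}}) (th : K).
Hypothesis th3 : th ^+ 3 = polyK K m.
Hypothesis dimK : \dim {:K} = 3%N.

Local Notation pK := (polyK K).
Local Notation toF := (@FracField.tofrac {poly F}).
Definition cub (a b c : {poly F}) : K := pK a + pK b * th + pK c * th ^+ 2.

(** The irreducible cubic with root [th] is coprime to every nonzero polynomial of smaller degree,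
    so the two cannot share the root [th]. *)
Lemma th_root_small (P : {poly {fraction {poly F}}}) :
  (size P <= 3)%N -> root (map_poly (in_alg K) P) th -> P = 0.
Proof.
move=> sP rP; apply/eqP; apply: contraT => P0.
have := irreducible_poly_coprime P (Xn3_subC_irredp im).
have -> : ~~ ('X^3 - (toF m)%:P %| P).
  by apply/negP => /(dvdp_leq P0); rewrite size_XnsubC // ltnNge sP.
rewrite -(coprimep_map (in_alg K)) => /coprimep_root /(_ _) H.
have /H : root (map_poly (in_alg K) ('X^3 - (toF m)%:P)) th.
  by rewrite rmorphB /= map_polyXn map_polyC /root !hornerE /= th3 subrr.
by rewrite (eqP rP) eqxx.
Qed.

Definition pows := [tuple th ^+ i | i < \dim {:K}].

Lemma pows_nth (i : 'I_(\dim {:K})) : pows`_i = th ^+ i.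
Proof. by rewrite -tnth_nth tnth_mktuple. Qed.

Lemma pows_basis : basis_of {:K} pows.
Proof.
rewrite basisEfree subvf size_tuple leqnn !andbT; apply/freeP => k Hk i.
(* A linear relation between the powers is read as a polynomial of size at most 3 vanishing at [th];
   the default 0 is never reached below the bound. *)
pose P : {poly {fraction {poly F}}} := \poly_(j < \dim {:K}) odflt 0 (omap k (insub j)).
have kE (j : 'I_(\dim {:K})) : P`_j = k j by rewrite coef_poly ltn_ord valK.
rewrite -kE (@th_root_small P) ?coef0 //.
  by rewrite (leq_trans (size_poly _ _)) ?dimK.
rewrite /root (@horner_coef_wide _ (\dim {:K})); last first.
  by rewrite size_map_poly size_poly.
rewrite -[X in _ == X]Hk; apply/eqP; apply: eq_bigr => j _.
by rewrite coef_map kE pows_nth /= mulr_algl.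
Qed.

Lemma sum_pows (V : nmodType) (f : nat -> V) :
  \sum_(i < \dim {:K}) f i = f 0%N + f 1%N + f 2%N.
Proof. by rewrite dimK !big_ord_recr big_ord0 /= add0r. Qed.

Lemma cub_den x : exists e a b c : {poly F}, e != 0 /\ pK e * x = cub a b c.
Proof.
have xE := coord_basis pows_basis (memvf x).
have [d [d0 dn]] : exists d, d != 0 /\ forall i, exists a, toF d * coord pows i x = toF a.
  have [r Hr] := fin_all_exists (fun i => fracP (coord pows i x)).
  have [s Hs] := fin_all_exists Hr.
  (* The product of the denominators of all coordinates is a common denominator. *)
  exists (\prod_i s i); split; first by apply/prodf_neq0 => i _; case: (Hs i).
  move=> i; have [s0 ->] := Hs i; rewrite (bigD1 i) //=.
  exists (r i * \prod_(j | j != i) s j); rewrite !tofracM.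
  by rewrite mulrC -mulrA mulKf // tofrac_eq0.
have [a aE] := fin_all_exists dn.
pose a' j := odflt 0 (omap a (insub j)).
have a'E (j : 'I_(\dim {:K})) : a' j = a j by rewrite /a' valK.
exists d, (a' 0%N), (a' 1%N), (a' 2%N); split=> //.
transitivity (\sum_(i < \dim {:K}) pK (a' i) * th ^+ i); last first.
  by rewrite (sum_pows (fun i => pK (a' i) * th ^+ i)) expr0 mulr1 expr1.
rewrite {1}xE mulr_sumr; apply: eq_bigr => i _.
by rewrite -scale_tofrac scalerA aE a'E pows_nth scale_tofrac.
Qed.

Lemma cub_eq0 a b c : cub a b c = 0 -> [/\ a = 0, b = 0 & c = 0].
Proof.
move=> H; pose P : {poly {fraction {poly F}}} := Poly [:: toF a; toF b; toF c].
have P0 : P = 0.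
  apply: th_root_small; first exact: size_Poly.
  rewrite /root -H map_Poly horner_Poly /= /cub mul0r add0r.
  by apply/eqP; rewrite -!/(pK _); ring.
have P0i i : [:: toF a; toF b; toF c]`_i = 0 by rewrite -coef_Poly -/P P0 coef0.
by split; apply/eqP; rewrite -tofrac_eq0; apply/eqP;
  [exact: (P0i 0) | exact: (P0i 1) | exact: (P0i 2)].
Qed.

Lemma cubB a b c a' b' c' : cub a b c - cub a' b' c' = cub (a - a') (b - b') (c - c').
Proof. by rewrite /cub !rmorphB; ring. Qed.

Lemma cub_inj a b c a' b' c' :
  cub a b c = cub a' b' c' -> [/\ a = a', b = b' & c = c'].
Proof.
move=> /eqP; rewrite -subr_eq0 cubB => /eqP/cub_eq0[/eqP+ /eqP+ /eqP].
by rewrite !subr_eq0 => /eqP-> /eqP-> /eqP->.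
Qed.

Lemma cubM a b c a' b' c' : cub a b c * cub a' b' c' =
  cub (a * a' + m * (b * c' + c * b'))
      (a * b' + b * a' + m * c * c')
      (a * c' + b * b' + c * a').
Proof.
rewrite /cub !(rmorphD, rmorphM) /= -th3; ring.
Qed.

Lemma cubD a b c a' b' c' : cub a b c + cub a' b' c' = cub (a + a') (b + b') (c + c').
Proof. by rewrite /cub !rmorphD; ring. Qed.

Lemma cubZ p a b c : pK p * cub a b c = cub (p * a) (p * b) (p * c).
Proof. by rewrite /cub !rmorphM; ring. Qed.

Lemma cub_thM a b c : th * cub a b c = cub (m * c) a b.
Proof. by rewrite /cub !rmorphM /= -th3; ring. Qed.

Lemma cub_polyK p : pK p = cub p 0 0.
Proof. by rewrite /cub !rmorph0; ring. Qed.

Lemma cub_th : th = cub 0 1 0.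
Proof. by rewrite /cub !rmorph0 rmorph1; ring. Qed.

(** This is the order F_q[t][[th]], shown below to be the whole ring of integers. *)
Definition in_cub (x : K) := exists a b c, x = cub a b c.

Lemma in_cub_polyK p : in_cub (pK p). Proof. by rewrite cub_polyK; do 3!eexists. Qed.
Lemma in_cub_th : in_cub th. Proof. by rewrite cub_th; do 3!eexists. Qed.
Lemma in_cubM x y : in_cub x -> in_cub y -> in_cub (x * y).
Proof. by move=> [a [b [c ->]]] [a' [b' [c' ->]]]; rewrite cubM; do 3!eexists. Qed.
Lemma in_cubD x y : in_cub x -> in_cub y -> in_cub (x + y).
Proof. by move=> [a [b [c ->]]] [a' [b' [c' ->]]]; rewrite cubD; do 3!eexists. Qed.
Lemma in_cub1 : in_cub 1.
Proof. by rewrite -(rmorph1 pK); exact: in_cub_polyK. Qed.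
Lemma in_cub0 : in_cub 0.
Proof. by rewrite -(rmorph0 pK); exact: in_cub_polyK. Qed.
Lemma in_cubX x n : in_cub x -> in_cub (x ^+ n).
Proof.
by move=> Hx; elim: n => [|n IH]; [exact: in_cub1 | rewrite exprS; exact: in_cubM].
Qed.

Lemma in_cub_integral x : in_cub x -> integralK x.
Proof.
move=> [a [b [c ->]]]; have int_th := integralK_cube_root th3.
apply/integralK_over; rewrite /cub expr2.
by do !apply: integral_add; do ?apply: integral_mul;
  apply/integralK_over; do ?[exact: integralK_polyK | exact: int_th].
Qed.

(** * The ring of integers *)

Definition divides_in_cub (pi z : K) := exists2 b, in_cub b & z = pi * b.

(* If [F[t][th]/(pi)] is reduced, then an integral [x] with [pi x] in [F[t][th]]
   is itself in [F[t][th]]: clearing denominators in the integral equation of [x]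
   shows that a power of [pi x] is divisible by [pi]. *)
Lemma integral_descent pi x :
  pi != 0 -> in_cub pi ->
  (forall z, in_cub z -> divides_in_cub pi (z ^+ 2) -> divides_in_cub pi z) ->
  integralK x -> in_cub (pi * x) -> in_cub x.
Proof.
move=> pi0 Bpi red [P [mP rP]] Bz.
have [n [b Bb Hn]] : exists n, divides_in_cub pi ((pi * x) ^+ n).
  exists (size P).-1.
  (* Multiplying the equation of [x] by [pi] to the degree of [P] leaves in the term of index [i] a
     surplus of degree minus [i], at least 1, factors [pi]; one of them is pulled out, hence the
     outer [.-1]. *)
  exists (- \sum_(i < (size P).-1) pK P`_i * pi ^+ ((size P).-1 - i).-1 * (pi * x) ^+ i).
    rewrite -mulN1r -(rmorphN1 pK); apply: in_cubM; first exact: in_cub_polyK.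
    elim/big_ind: _ => [|u v|i _]; [exact: in_cub0|exact: in_cubD|].
    by do !apply: in_cubM; do ?apply: in_cubX; rewrite //; exact: in_cub_polyK.
  have sP : (size P).-1.+1 = size P by rewrite prednK // size_poly_gt0 monic_neq0.
  move: rP; rewrite /root (@horner_coef_wide _ (size P).-1.+1);
    last by rewrite sP size_poly.
  rewrite big_ord_recr /= coef_map /= -/(lead_coef P) (monicP mP).
  rewrite rmorph1 mul1r addrC addr_eq0 => /eqP xE.
  rewrite exprMn xE !mulrN mulr_sumr mulr_sumr; congr (- _); apply: eq_bigr => i _.
  rewrite coef_map /= exprMn.
  have -> : pi ^+ (size P).-1 = pi * pi ^+ ((size P).-1 - i).-1 * pi ^+ i.
    by rewrite -exprS prednK ?subn_gt0 // -exprD subnK // ltnW.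
  by ring.
(* Reducedness concerns squares, so it descends along exponents [2 ^ k]; the exponent [n] is first
   raised to [2 ^ n]. *)
have H2 k : divides_in_cub pi ((pi * x) ^+ (2 ^ k)) -> divides_in_cub pi (pi * x).
  elim: k => [|k IH]; first by rewrite expr1.
  rewrite expnSr exprM => /red H; apply: IH; apply: H; exact: in_cubX.
have [|b' Bb' /(mulfI pi0) -> //] := H2 n.
exists (b * (pi * x) ^+ (2 ^ n - n)); first by apply: in_cubM => //; apply: in_cubX.
by rewrite -[in LHS](subnK (ltnW (ltn_expl n (ltnSn 1)))) exprD Hn; ring.
Qed.

(** The three coordinates of [z ^+ 2] are exactly the expressions in [pure_cubic_reduced]. *)
Lemma reduced_mod_p p : irreducible_poly p -> ~~ (p %| m) ->
  forall z, in_cub z -> divides_in_cub (pK p) (z ^+ 2) -> divides_in_cub (pK p) z.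
Proof.
move=> ip npm _ [a [b [c ->]]] [_ [a' [b' [c' ->]]]].
rewrite expr2 cubM cubZ => /cub_inj[ea eb ec].
have [|||/dvdpP[a1 ->] /dvdpP[b1 ->] /dvdpP[c1 ->]] :=
  @pure_cubic_reduced F p m a b c F3 ip npm.
- by rewrite (_ : _ + _ = p * a') ?dvdp_mulIl // -ea; ring.
- by rewrite (_ : _ + _ = p * b') ?dvdp_mulIl // -eb; ring.
- by rewrite (_ : _ + _ = p * c') ?dvdp_mulIl // -ec; ring.
by exists (cub a1 b1 c1); [do 3!eexists | rewrite cubZ !(mulrC p)].
Qed.

(** Modulo [th] only the constant coordinate modulo [m] survives, so the quotient is the field
    F_q[t]/([m]). This covers the prime [m], where the argument modulo [p] fails. *)
Lemma reduced_mod_th z : in_cub z -> divides_in_cub th (z ^+ 2) -> divides_in_cub th z.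
Proof.
move=> [a [b [c ->]]] [_ [a' [b' [c' ->]]]].
rewrite expr2 cubM cub_thM => /cub_inj[ea _ _].
have /(@irredp_dvdX _ _ _ 2 im)/dvdpP[a1 ->] : m %| a ^+ 2.
  rewrite (_ : a ^+ 2 = m * (c' - (b * c + c * b))) ?dvdp_mulIl // mulrBr -ea; ring.
by exists (cub b c a1); [do 3!eexists | rewrite cub_thM mulrC].
Qed.

Lemma polyKm_neq0 : pK m != 0. Proof. by rewrite polyK_eq0 irredp_neq0. Qed.
Lemma th_neq0 : th != 0.
Proof. by apply: contraNneq polyKm_neq0 => th0; rewrite -th3 th0 expr0n. Qed.

(** Induction on the size of a denominator [e], removing one irreducible factor [p] at a time by
    descent: with [pi] the image of [p] if [p] is prime to [m], and with [pi = th] otherwise. *)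
Lemma integral_in_cub x : integralK x -> in_cub x.
Proof.
have [e [a [b [c [e0 ex]]]]] := cub_den x.
have {a b c ex}: in_cub (pK e * x) by rewrite ex; do 3!eexists.
have [n] := ubnP (size e); elim: n e e0 x => // n IH e e0 x /ltnSE en Bx ix.
have [e1|e1] := leqP (size e) 1.
  have eC := size1_polyC e1; have u0 : e`_0 != 0 by rewrite -polyC_eq0 -eC.
  have -> : x = pK (e`_0)^-1%:P * (pK e * x).
    by rewrite mulrA -rmorphM /= {2}eC -polyCM mulVf // rmorph1 mul1r.
  by apply: in_cubM => //; exact: in_cub_polyK.
have [p ip /dvdpP[e' ee]] := irredp_factor e1.
have e'0 : e' != 0 by apply: contraNneq e0 => e'0; rewrite ee e'0 mul0r.
have int_e' : integralK (pK e' * x).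
  by apply: integralKM => //; exact: integralK_polyK.
have se : (size e' < n)%N.
  apply: leq_trans en; rewrite ee size_mul ?(irredp_neq0 ip) //; case: ip => p1 _.
  by move: p1; case: (size p) => [|[|k]] // _; rewrite !addnS ltnS leq_addr.
apply: (IH e') => //.
have {}Bx : in_cub (pK p * (pK e' * x)).
  by move: Bx; rewrite ee rmorphM /= mulrA (mulrC (pK p)).
have [pm|npm] := boolP (p %| m); last first.
  by apply: (integral_descent _ _ (reduced_mod_p ip npm)) Bx;
    rewrite ?polyK_eq0 ?irredp_neq0 //; exact: in_cub_polyK.
have th_step (y : K) : integralK y -> in_cub (th * y) -> in_cub y.
  exact: (integral_descent th_neq0 in_cub_th reduced_mod_th).
have /dvdpP[r er] := pm; have int_th := integralK_cube_root th3.
(* Three divisions by [th] amount to one by [th ^+ 3 = m], a multiple of [p]. *)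
do 3![apply: (th_step _); first by do ?[assumption | apply: integralKM]].
rewrite !mulrA -expr2 -exprSr th3 er rmorphM -!mulrA /=.
by apply: in_cubM => //; exact: in_cub_polyK.
Qed.

(** * The discriminant *)

Lemma coord_pows n i :
  coord pows i (th ^+ n) = toF m ^+ (n %/ 3) * (i == n %% 3 :> nat)%N%:R.
Proof.
have n3 : (n %% 3 < \dim {:K})%N by rewrite dimK ltn_mod.
rewrite [in LHS](divn_eq n 3) exprD mulnC exprM th3 -rmorphXn /= -scale_tofrac linearZ /=.
rewrite -(pows_nth (Ordinal n3)) coord_free ?(basis_free pows_basis) //.
by rewrite tofracXn eq_sym -val_eqE.
Qed.

Lemma traceK_pow k : traceK (th ^+ k) =
  \sum_(i < \dim {:K}) toF m ^+ ((i + k) %/ 3) * (i == (i + k) %% 3 :> nat)%N%:R.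
Proof.
rewrite (traceK_coord _ pows_basis); apply: eq_bigr => i _.
by rewrite pows_nth -exprD coord_pows.
Qed.

Lemma disc_pure_cubic : disc_generator K (- (27%:R * m ^+ 2)).
Proof.
exists (fun i => th ^+ i); split; [split; [|split]|].
- move=> i; apply: in_cub_integral; apply: in_cubX; exact: in_cub_th.
- move=> c c0 i; apply/eqP; rewrite -tofrac_eq0.
  have /freeP fr := basis_free pows_basis; rewrite (fr (fun i => toF (c i))) //.
  by rewrite -[RHS]c0; apply: eq_bigr => j _; rewrite pows_nth scale_tofrac.
- move=> x /integral_in_cub[a [b [c ->]]].
  exists (fun i => [:: a; b; c]`_i).
  by rewrite (sum_pows (fun i => pK [:: a; b; c]`_i * th ^+ i)) /= expr0 mulr1 expr1.
pose t k := traceK (th ^+ k).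
transitivity (\det (\matrix_(i < \dim {:K}, j < \dim {:K}) t (i + j)%N)); last first.
  by congr (\det _); apply/matrixP => i j; rewrite !mxE /t exprD.
(* The trace of [th ^+ k] is 3 times [m] to the power [k / 3] if 3 divides [k], and 0 otherwise;
   hence only [t 0 = 3] and [t 3 = 3 m] are nonzero among the entries, and the determinant is
   [-27 m^2]. *)
have tE k : t k = toF m ^+ (k %/ 3) * (0 == k %% 3)%N%:R +
   toF m ^+ ((1 + k) %/ 3) * (1 == (1 + k) %% 3)%N%:R +
   toF m ^+ ((2 + k) %/ 3) * (2 == (2 + k) %% 3)%N%:R.
  rewrite /t traceK_pow.
  exact: (sum_pows
    (fun i => toF m ^+ ((i + k) %/ 3) * (i == (i + k) %% 3 :> nat)%N%:R)).
rewrite (det_hankel3 _ dimK) !tE /= /divn /= tofracN tofracM tofracXn rmorph_nat.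
by ring.
Qed.

Lemma disc_coprime_pure_cubic g : ~~ (m %| g) -> disc_coprime_to K g.
Proof.
move=> nmg; exists (- (27%:R * m ^+ 2)); split; first exact: disc_pure_cubic.
move=> p ip pg; rewrite dvdpNr; apply: contra nmg => pd.
have F27 : 27%:R != 0 :> F by rewrite (natrM _ 3 9) (natrM _ 3 3) !mulf_neq0.
move: pd; rewrite -(rmorph_nat (@polyC F)) mul_polyC dvdpZr // => /(irredp_dvdX ip).
by move/(irredp_dvd ip im) => mp; exact: dvdp_trans mp pg.
Qed.

(** * Residues modulo [g] and failure of the Carmichael condition *)

Lemma cub_congr g a b c a' b' c' :
  congr_mod (pK g) (cub a b c) (cub a' b' c') <->
  [/\ g %| a - a', g %| b - b' & g %| c - c'].
Proof.
rewrite /congr_mod cubB; split.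
  move=> [z [/integral_in_cub[x [y [w ->]]]]].
  by rewrite cubZ => /cub_inj[-> -> ->]; rewrite !dvdp_mulIl.
move=> [/dvdpP[x ->] /dvdpP[y ->] /dvdpP[w ->]]; exists (cub x y w).
by rewrite cubZ !(mulrC g); split=> //; apply: in_cub_integral; do 3!eexists.
Qed.

(** Triples of remainders modulo [g] form a second system of representatives; sending each
    representative to a congruent one in the other system is injective both ways. *)
Lemma quot_card_pure_cubic g N : g != 0 -> quot_card (pK g) N ->
  N = ((#|F| ^ (size g).-1) ^ 3)%N.
Proof.
(* Row vectors of length [d = deg g] encode the polynomials of degree below [d], that is, the
   remainders modulo [g]. *)
move=> g0 [r [ir [injr surjr]]]; set d := (size g).-1.
pose T := ('rV[F]_d * 'rV[F]_d * 'rV[F]_d)%type.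
pose phi (t : T) := cub (rVpoly t.1.1) (rVpoly t.1.2) (rVpoly t.2).
have cardT : #|{: T}| = ((#|F| ^ d) ^ 3)%N.
  by rewrite !card_prod !card_mx !mul1n !expnS expn0 muln1 mulnA.
have sg : d.+1 = size g by rewrite prednK // size_poly_gt0.
have redK a : g %| a - rVpoly (poly_rV (a %% g) : 'rV[F]_d).
  rewrite poly_rV_K; last by rewrite -ltnS sg ltn_modp.
  by rewrite {1}(divp_eq a g) addrK dvdp_mull.
have small (u v : 'rV[F]_d) : g %| rVpoly u - rVpoly v -> u = v.
  rewrite -linearB => dv; apply/eqP; rewrite -subr_eq0; apply: contraT => uv0.
  have /dvdp_leq/(_ dv) : rVpoly (u - v) != 0.
    by apply: contraNneq uv0 => uv0; rewrite -[u - v]rVpolyK uv0 linear0.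
  by rewrite -sg ltnNge size_poly.
have [f fP] : exists f : 'I_N -> T, forall i, congr_mod (pK g) (r i) (phi (f i)).
  apply: (@fin_all_exists _ (fun=> T) (fun i t => congr_mod (pK g) (r i) (phi t))) => i.
  have [a [b [c ->]]] := integral_in_cub (ir i).
  by exists (poly_rV (a %% g), poly_rV (b %% g), poly_rV (c %% g)); apply/cub_congr.
have [h hP] : exists h : T -> 'I_N, forall t, congr_mod (pK g) (phi t) (r (h t)).
  apply: (@fin_all_exists _ (fun=> 'I_N) (fun t i => congr_mod (pK g) (phi t) (r i))) => t.
  apply: surjr; apply: in_cub_integral; by do 3!eexists.
have cs x y z : in_cub x -> in_cub y -> in_cub z ->
  congr_mod (pK g) x z -> congr_mod (pK g) y z -> congr_mod (pK g) x y.
  move=> [a [b [c ->]]] [a1 [b1 [c1 ->]]] [a2 [b2 [c2 ->]]].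
  move=> /cub_congr[xa xb xc] /cub_congr[ya yb yc]; apply/cub_congr.
  have dvdB (u v w : {poly F}) : g %| u - w -> g %| v - w -> g %| u - v.
    move=> uw vw; have -> : u - v = (u - w) - (v - w) by ring.
    exact: dvdp_sub.
  by split; [exact: dvdB ya | exact: dvdB yb | exact: dvdB yc].
have Br i : in_cub (r i) by exact: integral_in_cub.
have Bphi t : in_cub (phi t) by do 3!eexists.
apply/eqP; rewrite eqn_leq -cardT; apply/andP; split.
  rewrite -[leqLHS]card_ord; apply: (@leq_card _ _ f) => i j fij; apply: injr.
  by apply: (cs _ _ (phi (f i))) => //; rewrite fij; exact: fP.
rewrite -[leqRHS]card_ord; apply: (@leq_card _ _ h) => t t' htt'.
have /cub_congr[/small e1 /small e2 /small e3] : congr_mod (pK g) (phi t) (phi t').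
  by apply: (cs _ _ (r (h t))) => //; rewrite htt'; exact: hP.
by case: t t' e1 e2 e3 {htt'} => [[? ?] ?] [[? ?] ?] /= -> -> ->.
Qed.

Lemma not_carmichael_pure_cubic (g : {poly F}) : odd (size g).-1 ->
  ~~ (3 %| #|F|)%N -> ~~ (3 %| #|F|.-1)%N -> ~ carmichael_in (pK g).
Proof.
move=> og n3 n31 [_ [N [cN [_ powN]]]].
have g1 : (1 < size g)%N by case: (size g) og => [|[|]].
have g0 : g != 0 by rewrite -size_poly_gt0 (ltn_trans _ g1).
have N3 : (N %% 3 = 2)%N.
  rewrite (quot_card_pure_cubic g0 cN).
  have q2 : (#|F| %% 3 = 2)%N.
    case: #|F| (finNzRing_gt1 F) n3 n31 => // q _ /=.
    rewrite /dvdn -addn1 -modnDml.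
    by case: (q %% 3)%N (ltn_pmod q (isT : 0 < 3)%N) => [|[|[|]]].
  (* For degree 2k+1, [2^(2k+1) = 2 * 4^k] is 2 modulo 3, and so is its cube. *)
  rewrite -modnXm -(modnXm _ _ #|F|) q2 -(odd_double_half (size g).-1) og
    /= -mul2n expnD expnM.
  by rewrite -modnMm -(modnXm _ _ (2 ^ 2)) exp1n.
have /powN : integralK th by exact: (integralK_cube_root th3).
have -> : th ^+ N = cub 0 0 (m ^+ (N %/ 3)).
  by rewrite {1}(divn_eq N 3) N3 exprD mulnC exprM th3 /cub !rmorph0 rmorphXn; ring.
rewrite [X in congr_mod _ _ X]cub_th => /cub_congr[_ + _].
(* The coordinate on [th] is 0 in [th ^+ N] and 1 in [th], so [g] would divide 1. *)
by rewrite sub0r dvdpNr => /dvdp_leq; rewrite oner_neq0 size_poly1 leqNgt g1 => /(_ isT).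
Qed.

(** A cube root would be integral, hence some [cub a b c] whose cube has zero coordinates on [th]
    and [th ^+ 2]. These equations force [b = c = 0], so that [m'] would be the cube of a
    polynomial. *)
Lemma no_other_cube_root m' (x : K) :
  irreducible_poly m' -> ~~ (m %| m') -> x ^+ 3 <> pK m'.
Proof.
move=> im' nmm' x3.
have := integral_in_cub (integralK_cube_root x3).
case=> [a [b [c xE]]]; move: x3; rewrite xE cub_polyK !exprS expr0 mulr1 !cubM.
move=> /cub_inj [e0 e1 e2].
have P3 : 3%:R != 0 :> {poly F} by rewrite -(rmorph_nat (@polyC F)) polyC_eq0.
have {}e1 : a ^+ 2 * b + m * (a * c ^+ 2 + b ^+ 2 * c) = 0.
  by apply: (mulfI P3); rewrite mulr0 -e1; ring.
have {}e2 : a ^+ 2 * c + a * b ^+ 2 + m * b * c ^+ 2 = 0.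
  by apply: (mulfI P3); rewrite mulr0 -e2; ring.
have {}e0 : a ^+ 3 + m * (b ^+ 3 + m * c ^+ 3 + 6%:R * a * b * c) = m'.
  by rewrite -e0; ring.
have nma : ~~ (m %| a).
  by apply: contra nmm' => ma; rewrite -e0 dvdp_add // ?dvdp_mulIl // exprS dvdp_mulr.
(* Eliminating between the two vanishing coordinates; the second factor cannot vanish, since [m]
   would then divide [a]. *)
have /eqP : b * (a ^+ 3 - m ^+ 2 * c ^+ 3) = 0.
  have -> : b * (a ^+ 3 - m ^+ 2 * c ^+ 3) =
    a * (a ^+ 2 * b + m * (a * c ^+ 2 + b ^+ 2 * c))
      - m * c * (a ^+ 2 * c + a * b ^+ 2 + m * b * c ^+ 2) by ring.
  by rewrite e1 e2 !mulr0 subrr.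
rewrite mulf_eq0 subr_eq0 => /orP[/eqP b0|/eqP a3]; last first.
  case/negP: nma; apply: (@irredp_dvdX _ _ _ 3) => //.
  by rewrite a3 exprS -mulrA dvdp_mulIl.
move: e1; rewrite b0 !(mulr0, mul0r, expr0n) /= add0r addr0 => /eqP.
have a0 : a != 0 by apply: contraNneq nma => ->; rewrite dvdp0.
rewrite !mulf_eq0 (negPf (irredp_neq0 im)) (negPf a0) orbb /= => /eqP c0.
move: e0; rewrite b0 c0 !(mulr0, expr0n, addr0) => a3.
have /(irredp_not_cube_ratio im')/eqP : a ^+ 3 = m' * 1 ^+ 3 by rewrite a3 expr1n mulr1.
by rewrite oner_eq0.
Qed.

End PureCubic.

(** * An infinite family of pure cubic fields up to isomorphism *)

Lemma exists_pure_cubic (F : finFieldType) (m : {poly F}) : irreducible_poly m ->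
  exists (K : fieldExtType {fraction {poly F}}) (th : K),
    th ^+ 3 = polyK K m /\ \dim {:K} = 3%N.
Proof.
move=> im; have [K dimK [th rth _]] := irredp_FAdjoin (Xn3_subC_irredp im).
exists K, th; rewrite dimK size_XnsubC //; split=> //.
apply/eqP; rewrite -subr_eq0.
by move: rth; rewrite rmorphB /= map_polyXn map_polyC /root !hornerE.
Qed.

(** Each polynomial is chosen larger than the previous one; strictly growing sizes make the family
    pairwise non-associated. *)
Lemma irredp_increasing (F : finFieldType) (N : nat) :
  exists p : nat -> {poly F}, [/\ forall i, irreducible_poly (p i),
    forall i, (N < size (p i))%N & forall i j, (i < j)%N -> (size (p i) < size (p j))%N].
Proof.
have big k : exists p : {poly F}, irreducibleb p && (k < size p)%N.
  by have [p /irreducibleP ip kp] := irredp_large F k; exists p; rewrite ip.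
pose f k : {poly F} := xchoose (big k).
have fP k : irreducible_poly (f k) /\ (k < size (f k))%N.
  by have /andP[/irreducibleP] := xchooseP (big k).
pose p i : {poly F} := iter i (fun q : {poly F} => f (size q)) (f N).
have step i : (size (p i) < size (p i.+1))%N by case: (fP (size (p i))).
exists p; split.
- by case=> [|i]; [case: (fP N) | case: (fP (size (p i)))].
- by elim=> [|i IH]; [case: (fP N) | exact: ltn_trans (step i)].
- exact: (homo_ltn ltn_trans step).
Qed.

(** An isomorphism fixes F_q(t), so containing a cube root of [p] is an invariant of the isomorphism
    class. *)
Lemma ext_iso_cube_root (F : finFieldType)
    (K1 K2 : fieldExtType {fraction {poly F}}) p :
  ext_iso K1 K2 ->
  (exists x : K1, x ^+ 3 = polyK K1 p) <-> (exists y : K2, y ^+ 3 = polyK K2 p).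
Proof.
move=> [f [f' fK f'K]].
have fp : f (polyK K1 p) = polyK K2 p by rewrite /polyK linearZ /= rmorph1.
split=> [[x x3]|[y y3]].
  by exists (f x); rewrite -rmorphXn x3.
by exists (f' y); apply: (can_inj fK); rewrite rmorphXn /= f'K fp.
Qed.

(* "infinitely many" = infinitely many isomorphism classes: no finite family
   of extensions exhausts them up to isomorphism *)
Theorem theorem5p2 (F : finFieldType) (g : {poly F}) :
  squarefree_poly g -> odd (size g).-1 ->
  ~~ (3 %| #|F|)%N -> ~~ (3 %| #|F|.-1)%N ->
  forall (n : nat) (Ks : 'I_n -> fieldExtType {fraction {poly F}}),
  exists K : fieldExtType {fraction {poly F}},
    [/\ cubic_ext K, disc_coprime_to K g,
        ~ carmichael_in (polyK K g)
      & forall i, ~ ext_iso (Ks i) K].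
Proof.
move=> [g0 _] og n3 n31 n Ks.
have F3 := natr3_neq0 n3.
have [p [ip gp pmono]] := irredp_increasing F (size g).
apply: NNPP => noK.
(* If no field works, each of these [n.+1] pure cubic fields, which meet the first three conditions,
   is isomorphic to some [Ks i]. *)
have H (j : 'I_n.+1) : exists i, exists K : fieldExtType {fraction {poly F}},
    exists th : K, [/\ th ^+ 3 = polyK K (p j), \dim {:K} = 3%N & ext_iso (Ks i) K].
  have [K [th [th3 dimK]]] := exists_pure_cubic (ip j).
  apply: NNPP => noi; apply: noK; exists K; split=> //.
  - apply: (disc_coprime_pure_cubic F3 (ip j) th3 dimK).
    by apply: contraL (gp j) => /(dvdp_leq g0); rewrite -leqNgt.
  - exact: (not_carmichael_pure_cubic F3 (ip j) th3 dimK).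
  - by move=> i iso; apply: noi; exists i, K, th.
have [h hP] := fin_all_exists H.
have /injectivePn[j [j' jj' hjj']] : ~~ injectiveb h.
  apply/negP => /injectiveP/leq_card; by rewrite !card_ord ltnn.
have [K [th [th3 dimK iso]]] := hP j.
have [K' [th' [th3' dimK' iso']]] := hP j'.
(* The cube root of [p j] is carried from [K] through the common [Ks i] to [K'], the field of
   [p j']. *)
have /(ext_iso_cube_root (p j) iso) : exists y : K, y ^+ 3 = polyK K (p j) by exists th.
rewrite hjj' => /(ext_iso_cube_root (p j) iso')[y].
apply: (no_other_cube_root F3 (ip j') th3' dimK' (ip j)).
apply/negP => dv.
have /eqp_size eqs : p j' %= p j.
  by apply: (apply_irredp (ip j)) dv; case: (ip j') => /gtn_eqF ->.
move: jj'; rewrite neq_ltn => /orP[] /pmono; by rewrite eqs ltnn.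
Qed.
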